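(* Let $H=(V,E)$ be a connected hypergraph with $|V|\ge 2$, let $\Omega=\Omega(H)\subset\mathbb{R}^E_{\ge 0}$ be its multi-tree family, and let $\widehat{\Omega}$ be the Fulkerson blocker family of $\Omega$. Then $$\widehat{\Omega}=\left\{\frac{1}{|\mathscr{P}|-1}\mathbf{1}_{\delta(\mathscr{P})} : \mathscr{P}\text{ is a feasible partition of } V \text{ with } |\mathscr P|\ge 2 \text{ whose shrunk hypergraph } H_{\mathscr{P}} \text{ is vertex-biconnected}\right\}.$$
   Context: A hypergraph $H=(V,E)$ has a finite nonempty vertex set $V$ and a finite collection $E$ of subsets of $V$ (hyperedges), where repetitions are allowed (parallel hyperedges are distinct elements of $E$) and there are no loops (every hyperedge has at least two vertices). $H$ is connected if for every nonempty proper subset $X\subset V$ some hyperedge intersects both $X$ and $V\setminus X$. For $X\subseteq V$, $H[X]=(X,E[X])$ where $E[X]$ is the set of hyperedges contained in $X$. $\mathbf{1}_F\in\mathbb{R}^E$ is the indicator vector of $F\subseteq E$. Multi-tree family: a set (or multiset) $F$ of hyperedges is a hyperforest if $|F[X]|\le |X|-1$ for every nonempty $X\subseteq V$, where $F[X]$ is the collection of members of $F$ contained in $X$ (counted with multiplicity); a hyperforest with $|F|=|V|-1$ is a hypertree. For a multiset $A$ from $E$, $H[A]$ is the hypergraph with vertex set $\bigcup_{e\in A}e$ and hyperedges the members of $A$ (copies being parallel hyperedges), and its indicator vector $x^A\in\mathbb{R}^E_{\ge0}$ has $x^A(e)$ equal to the multiplicity of $e$ in $A$. $\Omega(H)$ is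 the set of all $x^A$ such that $H[A]$ is a hypertree with vertex set $V$. Blocker: for a set of vectors $\Gamma\subset\mathbb{R}^E_{\ge 0}$, $\operatorname{Adm}(\Gamma)=\{\rho\in\mathbb{R}^E_{\ge0}:\gamma^T\rho\ge 1\ \forall\gamma\in\Gamma\}$, and the Fulkerson blocker family $\widehat\Gamma$ is the set of extreme points of $\operatorname{Adm}(\Gamma)$. Partitions: for a partition $\mathscr P=\{V_1,\dots,V_k\}$ of $V$ (into nonempty parts), $|\mathscr P|=k$ and $\delta(\mathscr P)$ is the set of hyperedges intersecting at least two parts. $\mathscr P$ is feasible if every $H[V_i]$ is connected. For a hyperedge $f$, the contraction $H/f$ is obtained by merging the vertices of $f$ into one new vertex (in every hyperedge $e \ne f$ meeting $f$, replace $e\cap f$ by the new vertex) and removing resulting loops; $H/F$ is obtained by contracting all hyperedges of $F$. The shrunk hypergraph is $H_{\mathscr P}=H/(E\setminus\delta(\mathscr P))$; its vertices correspond to the parts of $\mathscr P$ and its hyperedges to $\delta(\mathscr P)$. Vertex-biconnected: for a vertex $v$, $H\setminus v$ is obtained by deleting $v$ from the vertex set and from all hyperedges containing it, discarding resulting empty hyperedges and loops. A (connected) hypergraph is vertex-biconnected if no single vertex deletion disconnects it. *)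

(* Defs.v *)
From HB Require Import structures.
From mathcomp Require Import all_boot all_order all_algebra.
Set Implicit Arguments.
Unset Strict Implicit.
Unset Printing Implicit Defensive.

(* Parallel hyperedges are distinct [e] with the same [ends e].  The vertex set
   is allowed to be empty only so that deleting a vertex is a total operation. *)
Record hypergraph := Hypergraph {
  vertex : finType;
  hedge : finType;
  ends : hedge -> {set vertex};
  ends_gt1 : forall e, 1 < #|ends e|
}.

Definition connected_hg (H : hypergraph) : Prop :=
  forall X : {set vertex H}, X != set0 -> X != [set: vertex H] ->
  exists e : hedge H, (ends e :&: X != set0) && (ends e :&: ~: X != set0).

Definition trace (T : finType) (X A : {set T}) : {set {x | x \in X}} :=
  [set x | val x \in A].

Lemma card_trace (T : finType) (X A : {set T}) : #|trace X A| = #|A :&: X|.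
Proof.
rewrite -(card_imset _ val_inj); apply: eq_card => x.
apply/imsetP/setIP => [[y + ->]|[xA xX]]; first by rewrite inE (valP y).
by exists (exist _ x xX); rewrite ?inE.
Qed.

Section Induced.
Variables (H : hypergraph) (X : {set vertex H}).

Definition hedges_in : {set hedge H} := [set e | ends e \subset X].

Lemma induced_gt1 (e : {e | e \in hedges_in}) : 1 < #|trace X (ends (val e))|.
Proof.
case: e => e /=; rewrite inE card_trace => /setIidPl ->; exact: ends_gt1.
Qed.

Definition induced : hypergraph := Hypergraph induced_gt1.

End Induced.

Section Deletion.
Variables (H : hypergraph) (v : vertex H).

(* The hyperedges that become neither empty nor a loop. *)
Definition kept_hedges : {set hedge H} := [set e | 1 < #|ends e :\ v|].

Lemma delete_vertex_gt1 (e : {e | e \in kept_hedges}) :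
  1 < #|trace [set~ v] (ends (val e))|.
Proof. by case: e => e /=; rewrite inE card_trace setDE. Qed.

Definition delete_vertex : hypergraph := Hypergraph delete_vertex_gt1.

End Deletion.

Definition vertex_biconnected (H : hypergraph) : Prop :=
  connected_hg H /\ forall v : vertex H, connected_hg (delete_vertex v).

Definition blocks_met (T : finType) (P : {set {set T}}) (A : {set T}) :
  {set {set T}} := [set B in P | A :&: B != set0].

Section Contraction.
Variables (H : hypergraph) (F : {set hedge H}).

Definition same_hedge : rel (vertex H) :=
  [rel u v | [exists e in F, (u \in ends e) && (v \in ends e)]].

(* All the contractions are made at once: a vertex of [H / F] is a set of
   vertices of [H] that get merged together. *)
Definition merged : {set {set vertex H}} :=
  equivalence_partition (connect same_hedge) [set: vertex H].

(* The hyperedges that do not become loops; none of them is in [F]. *)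
Definition uncontracted : {set hedge H} :=
  [set e | 1 < #|blocks_met merged (ends e)|].

Lemma contract_gt1 (e : {e | e \in uncontracted}) :
  1 < #|trace merged (blocks_met merged (ends (val e)))|.
Proof.
case: e => e /=; rewrite inE card_trace.
suff /setIidPl -> : blocks_met merged (ends e) \subset merged by [].
by apply/subsetP => B; rewrite inE => /andP[].
Qed.

Definition contract : hypergraph := Hypergraph contract_gt1.

End Contraction.

Section Partitions.
Variables (H : hypergraph) (P : {set {set vertex H}}).

Definition feasible_partition : Prop :=
  partition P [set: vertex H] /\
  forall X, X \in P -> connected_hg (induced X).

Definition delta : {set hedge H} := [set e | 1 < #|blocks_met P (ends e)|].

Definition shrunk : hypergraph := contract (~: delta).

End Partitions.

(* A multiset of hyperedges is given by its multiplicity function. *)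
Section Multisets.
Variables (H : hypergraph) (A : {ffun hedge H -> nat}).

Definition hyperforest : Prop :=
  forall X : {set vertex H}, X != set0 ->
  \sum_(e in hedges_in X) A e <= #|X| - 1.

Definition hypertree : Prop :=
  hyperforest /\ \sum_e A e = #|vertex H| - 1.

Definition multiset_vertices : {set vertex H} :=
  \bigcup_(e | 0 < A e) ends e.

End Multisets.

From mathcomp Require Import classical_sets reals.
Import GRing.Theory Num.Theory.
Local Open Scope ring_scope.

Section Blocker.
Variables (R : realType) (E : finType).

Definition indicator (F : {set E}) : {ffun E -> R} :=
  [ffun e => (e \in F)%:R].

Definition Adm (Gamma : set {ffun E -> R}) : set {ffun E -> R} :=
  [set rho | (forall e, 0 <= rho e) /\
     forall gamma, Gamma gamma -> 1 <= \sum_e gamma e * rho e]%classic.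

Definition extreme_points (C : set {ffun E -> R}) : set {ffun E -> R} :=
  [set x | C x /\
     forall y z (t : R), C y -> C z -> 0 < t < 1 ->
     (forall e, x e = t * y e + (1 - t) * z e) -> y = x /\ z = x]%classic.

Definition blocker (Gamma : set {ffun E -> R}) : set {ffun E -> R} :=
  extreme_points (Adm Gamma).

End Blocker.

Definition multi_trees (R : realType) (H : hypergraph) :
    set {ffun hedge H -> R} :=
  [set x | exists A : {ffun hedge H -> nat},
     [/\ hypertree A, multiset_vertices A = [set: vertex H]%SET &
         x = [ffun e => (A e)%:R]]]%classic.
Arguments multi_trees R H : clear implicits.
Arguments indicator R {E} F.

(* Main.v *)
(** Order hyperedges by their cost [rho] and run Kruskal's algorithm: the run
    produces a multi-tree [A], while the partitions [P] met on the way give a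
    dual solution, since a multi-tree uses at least [#|P| - 1] members of
    [delta P].  If [rho] is extreme and [P] is the partition into components of
    the zero-cost hyperedges, a small multiple of the cut point of [P] can
    therefore be split off [rho], so [rho] is that cut point.  A cut vertex of
    the shrunk hypergraph writes [delta P] as the disjoint union of two smaller
    cuts, so it is excluded by extremality.

    Conversely, let the cut point of [P] be a proper convex combination of [y]
    and [z] in [Adm].  Every multi-tree that is minimum for the cut point has
    [y]-cost [1].  For a part [p], a multi-tree of the shrunk hypergraph minus
    [p] becomes such a multi-tree on adding any hyperedge of [delta P] at [p];
    hence [y] takes the same value on all hyperedges of [delta P] meeting [p],
    and by connectivity [y] is constant on [delta P]. *)

Require Import Defs.
From HB Require Import structures.
From mathcomp Require Import all_boot all_order all_algebra.
From mathcomp Require Import classical_sets reals.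
From mathcomp Require Import boolp fintype finset zify lra ring.
Import Order.TTheory GRing.Theory Num.Theory.

Set Implicit Arguments.
Unset Strict Implicit.
Unset Printing Implicit Defensive.

Local Open Scope nat_scope.

(** On [X] the map [d] factors through [c]: the factor [h] picks a representative of each fibre. *)
Lemma leq_card_imset_factor (V S T : finType) (c : V -> S) (d : V -> T)
    (X : {set V}) :
  {in X &, forall x y, c x = c y -> d x = d y} -> #|d @: X| <= #|c @: X|.
Proof.
move=> cd; have [-> | [x0 x0X]] := set_0Vmem X; first by rewrite !imset0 !cards0.
pose h t := d (odflt x0 [pick x in X | c x == t]).
rewrite (_ : d @: X = h @: (c @: X)) ?leq_imset_card // -imset_comp.
apply: eq_in_imset => x xX; rewrite /= /h; case: pickP => /= [y /andP[yX /eqP]|].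
  by move=> yx; apply: cd; rewrite ?yx.
by move=> /(_ x); rewrite xX eqxx.
Qed.

(** * Kruskal runs, hypertrees and crossing hyperedges *)

Section Forests.
Variable H : hypergraph.
Implicit Types (A B : {ffun hedge H -> nat}) (e f : hedge H) (X Y : {set vertex H}).

(** A partition is encoded by a map [c] whose fibres are the parts, so that parts can be merged by
    changing values; this set is then the cut of that partition. *)
Definition crossing (T : finType) (c : vertex H -> T) : {set hedge H} :=
  [set e | 1 < #|c @: ends e|].

Lemma crossingP (T : finType) (c : vertex H -> T) e :
  reflect (exists a b, [/\ a \in ends e, b \in ends e & c a != c b])
          (e \in crossing c).
Proof.
rewrite inE; apply: (iffP card_gt1P) => [[_ [_ [/imsetP[a ae ->] /imsetP[b be ->] ab]]]|].
  by exists a, b.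
by move=> [a [b [ae be ab]]]; exists (c a), (c b); rewrite !imset_f.
Qed.

Lemma crossingPn (T : finType) (c : vertex H -> T) e :
  e \notin crossing c -> {in ends e &, forall a b, c a = c b}.
Proof.
move=> /crossingP ne a b ae be; apply/eqP/negPn/negP => ab.
by apply: ne; exists a, b.
Qed.

Lemma ends_exists e : exists a, a \in ends e.
Proof. by have /card_gt1P[a [_ [ae _ _]]] := ends_gt1 e; exists a. Qed.

Lemma connected_crossing (T : finType) (c : vertex H -> T) a b :
  connected_hg H -> c a != c b -> exists e, e \in crossing c.
Proof.
move=> Hc ab; have [||e /andP[/set0Pn[u /setIP[ue uX]] /set0Pn[v /setIP[ve vX]]]] :=
  Hc [set x | c x == c a].
- by apply/set0Pn; exists a; rewrite inE.
- by apply/eqP => /setP/(_ b); rewrite !inE eq_sym (negPf ab).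
exists e; apply/crossingP; exists u, v; split=> //.
by move: uX vX; rewrite !inE => /eqP ->; rewrite eq_sym.
Qed.

Definition madd A B : {ffun hedge H -> nat} := [ffun e => A e + B e].
Definition medge f : {ffun hedge H -> nat} := [ffun e => (e == f) : nat].

Lemma maddA A B C : madd A (madd B C) = madd (madd A B) C.
Proof. by apply/ffunP => e; rewrite !ffunE addnA. Qed.

Lemma sum_madd (Q : pred (hedge H)) A B :
  \sum_(e | Q e) madd A B e = \sum_(e | Q e) A e + \sum_(e | Q e) B e.
Proof. by rewrite -big_split; apply: eq_bigr => e _; rewrite ffunE. Qed.

Lemma sum_medge (Q : pred (hedge H)) f : \sum_(e | Q e) medge f e = Q f.
Proof.
under eq_bigr do rewrite ffunE.
rewrite -big_mkcondr /= sum1_card.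
case Qf: (Q f); last first.
  by apply: eq_card0 => e; rewrite unfold_in; case: eqP => [->|]; rewrite ?Qf ?andbF.
rewrite (eq_card (B := pred1 f)) ?card1 // => e.
by rewrite unfold_in /= inE; case: eqP => [->|]; rewrite ?Qf ?andbF.
Qed.

(* [A] is the multiset of the hyperedges used by a run of Kruskal's algorithm
   whose current components are the fibres of [c]. *)
Definition forest (T : finType) (c : vertex H -> T) A : Prop :=
  (forall X, \sum_(e in hedges_in X) A e + #|c @: X| <= #|X|) /\
  \sum_e A e + #|c @: setT| = #|vertex H|.

Lemma forest_id : forest id [ffun=> 0].
Proof.
have s0 (Q : pred (hedge H)) : \sum_(e | Q e) [ffun=> 0] e = 0.
  by rewrite big1 // => e _; rewrite ffunE.
by split=> [X|]; rewrite s0 (card_imset _ (@inj_id _)) ?cardsT.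
Qed.

Lemma forest_hypertree (T : finType) (c : vertex H -> T) A :
  forest c A -> #|c @: setT| = 1 -> hypertree A.
Proof.
move=> [FX FV] c1; split=> [X X0|]; last by lia.
have : 0 < #|c @: X| by rewrite card_gt0 imset_eq0.
by have := FX X; lia.
Qed.

Definition merge (T : finType) (c : vertex H -> T) a b : vertex H -> T :=
  fun x => if c x == c b then c a else c x.

(** Only the value [c b] leaves the image of [X], and its replacement [c a] is already there. *)
Lemma card_merge (T : finType) (c : vertex H -> T) a b X :
  a \in X -> b \in X -> c a != c b -> #|c @: X| = (#|merge c a b @: X|).+1.
Proof.
move=> aX bX ab; rewrite (cardsD1 (c b)) imset_f // add1n.
congr _.+1; apply: eq_card => t; apply/setD1P/imsetP => [[tb /imsetP[x xX tE]]|].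
  by exists x; rewrite // /merge -tE (negPf tb).
move=> [x xX ->]; rewrite /merge; case: (eqVneq (c x) (c b)) => xb.
  by split; rewrite ?imset_f.
by rewrite imset_f.
Qed.

Lemma merge_coarser (T : finType) (c : vertex H -> T) a b x y :
  c x = c y -> merge c a b x = merge c a b y.
Proof. by rewrite /merge => ->. Qed.

(** If [e] lies in [X], the unit it adds to the sum is paid for by the value that the image loses;
    otherwise the sum is unchanged and the image can only shrink. *)
Lemma forest_merge (T : finType) (c : vertex H -> T) A e a b :
  forest c A -> a \in ends e -> b \in ends e -> c a != c b ->
  forest (merge c a b) (madd A (medge e)).
Proof.
move=> [FX FV] ae be ab; split=> [X|]; rewrite sum_madd sum_medge.
  have := FX X; rewrite inE; case: (boolP (ends e \subset X)) => [eX|_].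
    by rewrite (@card_merge _ c a b) ?(subsetP eX) //=; lia.
  have : #|merge c a b @: X| <= #|c @: X|; last by lia.
  by apply: leq_card_imset_factor => x y _ _; exact: merge_coarser.
by move: FV; rewrite (@card_merge _ c a b) ?inE //=; lia.
Qed.

(* Merges inside [F], restricted to [U], are made as long as possible; deleting
   a vertex amounts to taking [U] to be its complement. *)
Lemma forest_grow (T : finType) (U : {set vertex H}) (F : {set hedge H})
    (c : vertex H -> T) A :
  forest c A -> exists (c' : vertex H -> T) A1,
  [/\ forest c' (madd A A1), forall e, 0 < A1 e -> e \in F,
      forall x y, c x = c y -> c' x = c' y,
      forall e a b, e \in F -> a \in ends e :&: U -> b \in ends e :&: U ->
        c' a = c' b &
      forall Y, (forall x y, c x = c y -> x \in Y -> y \in Y) ->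
        forall x y, x \in Y -> y \notin Y -> c' x = c' y ->
        exists e u v, [/\ e \in F, u \in ends e :&: U, v \in ends e :&: U,
                          u \in Y & v \notin Y]].
Proof.
have [n] := ubnP #|c @: setT|; elim: n => // n IHn in c A * => cn FcA.
case: (pselect (exists e a b, [/\ e \in F, a \in ends e :&: U,
                 b \in ends e :&: U & c a != c b])) => [|maximal]; last first.
  exists c, [ffun=> 0]; split=> //.
  - by rewrite (_ : madd _ _ = A) //; apply/ffunP => e; rewrite !ffunE addn0.
  - by move=> e; rewrite ffunE.
  - move=> e a b eF ae be; apply/eqP/negPn/negP => ab.
    by apply: maximal; exists e, a, b.
  - by move=> Y Ysat x y xY /negP yY xy; case: yY; exact: Ysat xy xY.
move=> [e [a [b [eF aeU beU ab]]]].
have [ae be] : a \in ends e /\ b \in ends e.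
  by move: aeU beU => /setIP[-> _] /setIP[-> _].
have [|c' [A1 [F' A1F cc' mono conn]]] :=
  IHn _ _ _ (forest_merge FcA ae be ab).
  by move: cn; rewrite (@card_merge _ c a b) ?inE.
exists c', (madd (medge e) A1); split=> //.
- by rewrite maddA.
- by move=> g; rewrite !ffunE; case: eqP => [->|_]; rewrite ?add0n //; apply: A1F.
- by move=> x y xy; apply/cc'/merge_coarser.
move=> Y Ysat x y xY yY xy.
(* If [e] itself leaves [Y], it is the witness; otherwise [Y] is still a union of fibres after the
   merge and the induction hypothesis applies. *)
case aY: (a \in Y); case bY: (b \in Y).
- apply: (conn Y) xY yY xy => u v; rewrite /merge.
  case: (eqVneq (c u) (c b)) => ub; case: (eqVneq (c v) (c b)) => vb.
  + by move=> _ _; apply: (Ysat b).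
  + by move=> av _; apply: (Ysat a).
  + by move=> _ _; apply: (Ysat b).
  + exact: Ysat.
- by exists e, a, b; rewrite bY.
- by exists e, b, a; rewrite aY.
- apply: (conn Y) xY yY xy => u v; rewrite /merge.
  case: (eqVneq (c u) (c b)) => ub; case: (eqVneq (c v) (c b)) => vb.
  + by move=> _ /(Ysat _ _ ub); rewrite bY.
  + by move=> _ /(Ysat _ _ ub); rewrite bY.
  + by move=> /Ysat ua /ua; rewrite aY.
  + exact: Ysat.
Qed.

(** A fibre with m vertices contains at most m - 1 members of [A]; summed over the fibres, this
    bounds the non-crossing members by the number of vertices minus the number of fibres. *)
Lemma hypertree_crossing (T : finType) (c : vertex H -> T) A :
  hypertree A -> #|c @: setT| - 1 <= \sum_(e in crossing c) A e.
Proof.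
move=> [FX FV].
have inner : \sum_(e | e \notin crossing c) A e <=
    \sum_(t in c @: setT) \sum_(e in hedges_in (c @^-1: [set t])) A e.
  rewrite (exchange_big_dep predT) //= [leqRHS](bigID (mem (crossing c))) /=.
  apply: leq_trans (leq_addl _ _); apply: leq_sum => e /crossingPn ce.
  have [a ae] := ends_exists e.
  rewrite (bigD1 (c a)) ?leq_addr //= imset_f //= inE.
  by apply/subsetP => x xe; rewrite !inE; apply/eqP/ce.
have outer : \sum_(t in c @: setT) \sum_(e in hedges_in (c @^-1: [set t])) A e
    + #|c @: setT| <= #|vertex H|.
  rewrite -sum1_card -big_split /= -cardsT -sum1_card.
  rewrite [leqRHS](partition_big_imset c) /=; apply: leq_sum => t.
  move=> /imsetP[x _ tE]; have x_t : x \in c @^-1: [set t] by rewrite !inE tE.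
  have : #|c @^-1: [set t]| = \sum_(y in [set: vertex H] | c y == t) 1.
    by rewrite -sum1_card; apply: eq_bigl => y; rewrite !inE.
  have /FX : c @^-1: [set t] != set0 by apply/set0Pn; exists x.
  have : 0 < #|c @^-1: [set t]| by rewrite card_gt0; apply/set0Pn; exists x.
  lia.
have := leq_trans (leq_add inner (leqnn _)) outer.
move: FV; rewrite (bigID (mem (crossing c))) /=.
by set u := bigop _ _ _; set v := bigop _ _ _; lia.
Qed.

(** If [v] were missed, all |V| - 1 members would lie in the nonempty complement of [v], which holds
    at most |V| - 2 of them. *)
Lemma hypertree_cover A :
  2 <= #|vertex H| -> hypertree A -> multiset_vertices A = setT.
Proof.
move=> V2 [FX FV]; apply/setP => v; rewrite inE; apply/negPn/negP => vA.
have : \sum_(e in hedges_in [set~ v]) A e = \sum_e A e.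
  rewrite [RHS](bigID (mem (hedges_in [set~ v]))) /= [X in _ = _ + X]big1 ?addn0 //.
  move=> e; rewrite inE => eV; apply/eqP; rewrite -leqn0 leqNgt.
  apply: contra vA => Ae; apply/bigcupP; exists e => //.
  apply: contraR eV => ve; apply/subsetP => x xe; rewrite !inE.
  by apply: contraNneq ve => <-.
have : #|[set~ v]| = #|vertex H| - 1 by rewrite cardsC1 subn1.
have := FX [set~ v]; rewrite -card_gt0; lia.
Qed.

Lemma weight_support (R : pzRingType) (D : {set hedge H}) A (rho : hedge H -> R) :
  (forall e, 0 < A e -> e \in D) ->
  (\sum_(e in D) (A e)%:R * rho e = \sum_e (A e)%:R * rho e)%R.
Proof.
move=> AD; rewrite [RHS](bigID (mem D)) /= [X in (_ + X)%R]big1 ?addr0 // => e.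
by case: (posnP (A e)) => [->|/AD ->]; rewrite ?mul0r.
Qed.

Lemma weightB (R : pzRingType) (D : pred (hedge H)) A (rho : hedge H -> R) (m : R) :
  (\sum_(e | D e) (A e)%:R * (rho e - m) =
   \sum_(e | D e) (A e)%:R * rho e - (\sum_(e | D e) A e)%:R * m)%R.
Proof.
rewrite (eq_bigr (fun e => (A e)%:R * rho e - (A e)%:R * m)%R); last first.
  by move=> e _; rewrite mulrBr.
by rewrite sumrB -mulr_suml natr_sum.
Qed.

(* Induction on the number of components: the cheapest crossing hyperedge is
   taken, and its cost is subtracted from all the crossing hyperedges. *)
Lemma kruskal (R : realDomainType) (T : finType) (c : vertex H -> T) A
    (rho : hedge H -> R) :
  connected_hg H -> 0 < #|vertex H| -> forest c A ->
  (forall e, e \in crossing c -> 0 <= rho e)%R ->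
  exists A1, [/\ hypertree (madd A A1), forall e, 0 < A1 e -> e \in crossing c &
    forall B, hypertree B -> (\sum_(e in crossing c) (A1 e)%:R * rho e <=
                              \sum_(e in crossing c) (B e)%:R * rho e)%R].
Proof.
move=> Hc V0; have [n] := ubnP #|c @: setT|.
elim: n => // n IHn in c A rho * => cn FcA rho0.
have [c1 | c1] := leqP #|c @: setT| 1.
  have noc e : e \notin crossing c.
    rewrite inE -leqNgt; apply: leq_trans c1; apply/subset_leq_card/imsetS.
    exact: subsetT.
  exists [ffun=> 0]; split.
  - rewrite (_ : madd _ _ = A); last by apply/ffunP => e; rewrite !ffunE addn0.
    apply: forest_hypertree FcA _; apply/eqP; rewrite eqn_leq c1 card_gt0.
    by rewrite imset_eq0 -card_gt0 cardsT.
  - by move=> e; rewrite ffunE.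
  - by move=> B _; rewrite !big1 // => e; rewrite (negPf (noc e)).
have [e0 e0c] : exists e, e \in crossing c.
  move: c1 => /card_gt1P[_ [_ [/imsetP[a _ ->] /imsetP[b _ ->] ab]]].
  exact: connected_crossing Hc ab.
have [e ec emin] := Order.TotalTheory.arg_minP rho e0c.
have /crossingP[a [b [ae be ab]]] := ec.
have sub g : g \in crossing (merge c a b) -> g \in crossing c.
  move=> /crossingP[u [v [ug vg uv]]]; apply/crossingP; exists u, v; split=> //.
  by apply: contraNneq uv => uv; apply/eqP/merge_coarser.
have [||A1 [htA A1c minA]] := IHn (merge c a b) (madd A (medge e))
   (fun g => rho g - rho e)%R _ (forest_merge FcA ae be ab).
- by move: cn; rewrite (@card_merge _ c a b) ?inE.
- by move=> g gc; rewrite subr_ge0; apply/emin/sub.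
have A1c' g : 0 < madd (medge e) A1 g -> g \in crossing c.
  by rewrite !ffunE; case: eqP => [->|_]; rewrite ?add0n // => /A1c /sub.
exists (madd (medge e) A1); rewrite maddA; split=> // B htB.
(* [A1] has two members fewer than there are components, while [B] has at least one crossing member
   per component but one: the extra member pays for [e]. *)
have A1k : (\sum_g A1 g).+2 = #|c @: setT|.
  have [_] := htA; have [_] := forest_merge FcA ae be ab.
  by rewrite (sum_madd _ _ A1) (@card_merge _ c a b) ?inE //; lia.
rewrite weight_support //; under eq_bigr do rewrite ffunE natrD mulrDl.
rewrite big_split /= (bigD1 e) //= ffunE eqxx mul1r.
rewrite [X in (_ + X + _)%R]big1 ?addr0; last first.
  by move=> g /negPf ge; rewrite ffunE ge mul0r.
have := minA B htB; rewrite weight_support // weightB.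
(* Hyperedges that stop crossing after the merge have nonnegative reduced cost, by the choice of
   [e]. *)
have subw : (\sum_(g in crossing (merge c a b)) (B g)%:R * (rho g - rho e) <=
   \sum_(g in crossing c) (B g)%:R * (rho g - rho e))%R.
  rewrite [leRHS](bigID (mem (crossing (merge c a b)))) /=.
  rewrite [X in (_ <= X + _)%R](eq_bigl (mem (crossing (merge c a b)))); last first.
    by move=> g; rewrite andb_idl // => /sub.
  rewrite lerDl sumr_ge0 // => g /andP[gc _].
  by rewrite mulr_ge0 ?ler0n // subr_ge0; apply: emin.
move=> /le_trans/(_ subw); rewrite weightB lerBlDr => minA'.
have : ((\sum_g A1 g).+1%:R * rho e <= (\sum_(g in crossing c) B g)%:R * rho e)%R.
  rewrite ler_wpM2r ?rho0 // ler_nat.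
  by have := hypertree_crossing c htB; rewrite -A1k subn1.
rewrite -natr1 mulrDl mul1r => wB.
by move: wB minA'; lra.
Qed.

End Forests.

(** * Partitions as the fibres of [pblock] *)

Section Partitions.
Variable T : finType.
Implicit Types (P : {set {set T}}) (x y : T).

Lemma pblockT P x : partition P setT -> pblock P x \in P.
Proof. by move=> Ppart; rewrite pblock_mem // (cover_partition Ppart) inE. Qed.

Lemma mem_pblockT P x : partition P setT -> x \in pblock P x.
Proof. by move=> Ppart; rewrite mem_pblock (cover_partition Ppart) inE. Qed.

Lemma pblock_eq P B x : partition P setT -> B \in P -> x \in B -> pblock P x = B.
Proof. by move=> /and3P[_ tP _]; exact: def_pblock. Qed.

Lemma same_pblockT P x y :
  partition P setT -> (pblock P x == pblock P y) = (y \in pblock P x).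
Proof.
move=> Ppart; apply/eqP/idP => [->|yx]; first exact: mem_pblockT.
by rewrite (pblock_eq Ppart (pblockT x Ppart) yx).
Qed.

Lemma blocks_met_pblock P (A : {set T}) :
  partition P setT -> blocks_met P A = pblock P @: A.
Proof.
move=> Ppart; apply/setP => B; rewrite inE; apply/andP/imsetP => [[BP]|[x xA ->]].
  by case/set0Pn => x /setIP[xA xB]; exists x; rewrite ?(pblock_eq Ppart BP).
split; first exact: pblockT.
by apply/set0Pn; exists x; rewrite inE xA mem_pblockT.
Qed.

Lemma imset_pblock P : partition P setT -> pblock P @: setT = P.
Proof.
move=> Ppart; apply/setP => B; apply/imsetP/idP => [[x _ ->]|BP].
  exact: pblockT.
have /set0Pn[x xB] : B != set0.
  by case/and3P: Ppart => _ _ P0; apply: contraNneq P0 => <-.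
by exists x; rewrite ?inE // (pblock_eq Ppart BP).
Qed.

End Partitions.

(** * Connectedness of induced and vertex-deleted hypergraphs *)

(** Moves connectedness from subtypes to vertices and hyperedges of [H]: separating sets pass over
    by [trace] and return as images under [val]. *)
Lemma induced_connectedP (H : hypergraph) (X : {set vertex H}) :
  connected_hg (induced X) <->
  forall (Y : {set vertex H}) a b, a \in X -> b \in X -> a \in Y -> b \notin Y ->
  exists e u v, [/\ ends e \subset X, u \in ends e, v \in ends e,
                    u \in Y & v \notin Y].
Proof.
split=> [HX Y a b aX bX aY bY | HX Y /set0Pn[a aY] YT].
  have [||e /andP[/set0Pn[u /setIP[ue uY]] /set0Pn[v /setIP[ve vY]]]] := HX (trace X Y).
  - by apply/set0Pn; exists (exist _ a aX); rewrite inE.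
  - by apply/eqP => /setP/(_ (exist _ b bX)); rewrite !inE /= (negPf bY).
  move: ue uY ve vY; rewrite !inE => ue uY ve vY.
  exists (val e), (val u), (val v); split=> //.
  by have := valP e; rewrite inE.
have [b bY] : exists b, b \notin Y.
  by apply/existsP; rewrite -negb_forall; apply: contra YT => /forallP YT;
     apply/eqP/setP => x; rewrite YT inE.
have [||||e [u [v [eX ue ve uY vY]]]] := HX (val @: Y) (val a) (val b).
- exact: valP.
- exact: valP.
- exact: imset_f.
- by rewrite mem_imset //; exact: val_inj.
have eX' : e \in hedges_in X by rewrite inE.
exists (exist _ e eX'); apply/andP; split; apply/set0Pn.
  case/imsetP: uY ue => u' u'Y -> ue; exists u'.
  by rewrite !inE ue.
have vX := subsetP eX _ ve; exists (exist _ v vX); rewrite !inE ve /=.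
by apply: contra vY => vY; apply/imsetP; exists (exist _ v vX).
Qed.

Lemma delete_connectedP (H : hypergraph) (p : vertex H) :
  connected_hg (delete_vertex p) <->
  forall (Y : {set vertex H}) a b, a != p -> b != p -> a \in Y -> b \notin Y ->
  exists e u v, [/\ u \in ends e, v \in ends e, u != p /\ v != p,
                    u \in Y & v \notin Y].
Proof.
split=> [Hp Y a b ap bp aY bY | Hp Y /set0Pn[a aY] YT].
  have ap' : a \in [set~ p] by rewrite !inE.
  have bp' : b \in [set~ p] by rewrite !inE.
  have [||e /andP[/set0Pn[u /setIP[ue uY]] /set0Pn[v /setIP[ve vY]]]] :=
    Hp (trace [set~ p] Y).
  - by apply/set0Pn; exists (exist _ a ap'); rewrite inE.
  - by apply/eqP => /setP/(_ (exist _ b bp')); rewrite !inE /= (negPf bY).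
  move: ue uY ve vY; rewrite !inE => ue uY ve vY.
  have := valP u; have := valP v; rewrite !inE => up vp.
  by exists (val e), (val u), (val v).
have [b bY] : exists b, b \notin Y.
  by apply/existsP; rewrite -negb_forall; apply: contra YT => /forallP YT;
     apply/eqP/setP => x; rewrite YT inE.
have [||||e [u [v [ue ve [up vp] uY vY]]]] := Hp (val @: Y) (val a) (val b).
- by have := valP a; rewrite !inE.
- by have := valP b; rewrite !inE.
- exact: imset_f.
- by rewrite mem_imset //; exact: val_inj.
have ek : e \in kept_hedges p.
  rewrite inE; apply/card_gt1P; exists u, v; rewrite !inE up vp; split=> //.
  by apply: contraNneq vY => <-.
exists (exist _ e ek); apply/andP; split; apply/set0Pn.
  case/imsetP: uY ue => u' u'Y -> ue; exists u'.
  by rewrite !inE ue.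
have vp' : v \in [set~ p] by rewrite !inE.
exists (exist _ v vp'); rewrite !inE ve /=.
by apply: contra vY => vY; apply/imsetP; exists (exist _ v vp').
Qed.

(** * Contractions and shrunk hypergraphs *)

Section Contract.
Variables (H : hypergraph) (F : {set hedge H}).

Lemma same_hedge_equivalence : equivalence_rel (connect (@same_hedge H F)).
Proof.
have sym : connect_sym (@same_hedge H F).
  apply: sym_connect_sym => x y; apply: eq_existsb => e.
  by rewrite /= [X in _ && X]andbC.
move=> x y z; split=> // xy; apply/idP/idP; apply: connect_trans => //.
by rewrite sym.
Qed.

Lemma merged_partition : partition (merged F) setT.
Proof. by apply: equivalence_partitionP => x y z _ _ _; exact: same_hedge_equivalence. Qed.

Lemma mem_pblock_merged x y :
  (y \in pblock (merged F) x) = connect (@same_hedge H F) x y.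
Proof.
by rewrite pblock_equivalence_partition ?inE // => ? ? ? _ _ _; exact: same_hedge_equivalence.
Qed.

Definition contract_vertex (x : vertex H) : vertex (contract F) :=
  exist _ (pblock (merged F) x) (pblockT x merged_partition).

Lemma contract_vertexP (w : vertex (contract F)) : exists x, w = contract_vertex x.
Proof.
have /imsetP[x _ wx] : val w \in pblock (merged F) @: setT.
  by rewrite imset_pblock ?merged_partition //; exact: valP.
by exists x; apply: val_inj.
Qed.

Lemma contract_vertex_eq x y :
  (contract_vertex x == contract_vertex y) = (pblock (merged F) x == pblock (merged F) y).
Proof. by rewrite -val_eqE. Qed.

Lemma mem_contract_ends (e : hedge (contract F)) x :
  x \in ends (val e) -> contract_vertex x \in ends e.
Proof.
by move=> xe; rewrite inE blocks_met_pblock ?merged_partition //= imset_f.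
Qed.

Lemma contract_endsP (e : hedge (contract F)) w :
  w \in ends e -> exists2 x, x \in ends (val e) & w = contract_vertex x.
Proof.
rewrite inE blocks_met_pblock ?merged_partition // => /imsetP[x xe wx].
by exists x => //; apply: val_inj.
Qed.

Lemma uncontracted_crossing : uncontracted F = crossing (pblock (merged F)).
Proof. by apply/setP => e; rewrite !inE blocks_met_pblock ?merged_partition. Qed.

(** A separating set pulls back to [H], and a hyperedge crossing its preimage meets two merged
    classes, so it survives the contraction. *)
Lemma contract_connected : connected_hg H -> connected_hg (contract F).
Proof.
move=> Hc Y /set0Pn[a aY] YT.
have [b bY] : exists b, b \notin Y.
  by apply/existsP; rewrite -negb_forall; apply: contra YT => /forallP YT;
     apply/eqP/setP => x; rewrite YT inE.
have [x ax] := contract_vertexP a; have [y b_y] := contract_vertexP b.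
have [||e /andP[/set0Pn[u /setIP[ue uY]] /set0Pn[v /setIP[ve vY]]]] :=
  Hc [set z | contract_vertex z \in Y].
- by apply/set0Pn; exists x; rewrite inE -ax.
- by apply/eqP => /setP/(_ y); rewrite !inE -b_y (negPf bY).
move: uY vY; rewrite !inE => uY vY.
have ek : e \in uncontracted F.
  rewrite uncontracted_crossing; apply/crossingP; exists u, v; split=> //.
  by rewrite -contract_vertex_eq; apply: contraNneq vY => <-.
exists (exist _ e ek); apply/andP; split; apply/set0Pn.
  by exists (contract_vertex u); rewrite in_setI uY mem_contract_ends.
by exists (contract_vertex v); rewrite in_setI in_setC vY mem_contract_ends.
Qed.

(** Brings cut vertices of the contraction back to [H]: vertices become representatives, and sets of
    vertices become unions of merged classes. *)
Lemma delete_contract_connectedP :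
  (forall w : vertex (contract F), connected_hg (delete_vertex w)) <->
  forall (Y : {set vertex H}) p a b,
  (forall x y, pblock (merged F) x = pblock (merged F) y -> x \in Y -> y \in Y) ->
  pblock (merged F) a != pblock (merged F) p ->
  pblock (merged F) b != pblock (merged F) p -> a \in Y -> b \notin Y ->
  exists e u v, [/\ u \in ends e, v \in ends e,
    pblock (merged F) u != pblock (merged F) p /\
    pblock (merged F) v != pblock (merged F) p, u \in Y & v \notin Y].
Proof.
split=> [HF Y p a b Ysat ap bp aY bY | HF w].
  have YE z : (contract_vertex z \in contract_vertex @: Y) = (z \in Y).
    apply/imsetP/idP => [[z' z'Y /(congr1 val) zz']|zY]; last by exists z.
    by apply: Ysat z'Y; rewrite -[LHS]zz'.
  have /delete_connectedP := HF (contract_vertex p).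
  move=> /(_ (contract_vertex @: Y) (contract_vertex a) (contract_vertex b)).
  rewrite !contract_vertex_eq !YE => /(_ ap bp aY bY).
  move=> [e [u [v [/contract_endsP[x xe ->] /contract_endsP[y ye ->]]]]].
  by rewrite !contract_vertex_eq !YE => -[xp yp] xY yY; exists (val e), x, y.
have [p ->] := contract_vertexP w; apply/delete_connectedP => Y a b.
have [x ->] := contract_vertexP a; have [y ->] := contract_vertexP b.
rewrite !contract_vertex_eq => xp yp xY yY.
have [|||||e [u [v [ue ve]]]] := HF [set z | contract_vertex z \in Y] p x y.
- move=> z z' zz'; rewrite !inE (_ : contract_vertex z = contract_vertex z') //.
  exact: val_inj.
- by [].
- by [].
- by rewrite inE.
- by rewrite inE.
rewrite !inE -!contract_vertex_eq => -[up vp] uY vY.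
have ek : e \in uncontracted F.
  rewrite uncontracted_crossing; apply/crossingP; exists u, v; split=> //.
  by rewrite -contract_vertex_eq; apply: contraNneq vY => <-.
by exists (exist _ e ek), (contract_vertex u), (contract_vertex v);
   rewrite !mem_contract_ends.
Qed.

End Contract.

Lemma delta_crossing (H : hypergraph) (P : {set {set vertex H}}) :
  partition P setT -> delta P = crossing (pblock P).
Proof. by move=> Ppart; apply/setP => e; rewrite !inE blocks_met_pblock. Qed.

Lemma subset_block_delta (H : hypergraph) (P : {set {set vertex H}}) B (e : hedge H) :
  partition P setT -> B \in P -> ends e \subset B -> e \notin delta P.
Proof.
move=> Ppart BP /subsetP eB; rewrite delta_crossing //; apply/crossingP.
move=> [u [v [/eB uB /eB vB /eqP[]]]].
by rewrite (pblock_eq Ppart BP uB) (pblock_eq Ppart BP vB).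
Qed.

(** Hyperedges outside [delta P] never leave a part, so merging stays inside the parts;
    connectedness of the parts makes it fill them. *)
Lemma merged_delta (H : hypergraph) (P : {set {set vertex H}}) :
  feasible_partition P -> merged (~: delta P) = P.
Proof.
move=> [Ppart Pconn].
rewrite -[RHS](imset_pblock Ppart) -[LHS](imset_pblock (merged_partition _)).
apply: eq_imset => x; apply/setP => y.
rewrite mem_pblock_merged; apply/idP/idP => [|xy].
  move=> /(@closed_connect _ _ (mem (pblock P x))) <-; first exact: mem_pblockT.
  move=> u v /existsP[e /andP[eP /andP[ue ve]]].
  rewrite /= -!same_pblockT //; congr (_ == _).
  by move: eP; rewrite inE delta_crossing // => /crossingPn; apply.
apply: contraT => nxy.
have /induced_connectedP := Pconn _ (pblockT x Ppart).
move=> /(_ [set z | connect (@same_hedge H (~: delta P)) x z] x y).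
rewrite !inE mem_pblockT // => /(_ erefl xy (connect0 _ _) nxy).
move=> [e [u [v [eX ue ve]]]]; rewrite !inE => xu /negP[].
apply: connect_trans xu (connect1 _); apply/existsP; exists e.
by rewrite ue ve inE (subset_block_delta Ppart (pblockT x Ppart)).
Qed.

Local Open Scope ring_scope.

(** * Cut points, and the form of the extreme points *)

Section Cuts.
Variables (R : realType) (H : hypergraph).
Implicit Types (A B : {ffun hedge H -> nat}) (rho : {ffun hedge H -> R}).

(** For [c] equal to [pblock P] this is the vector that the theorem attaches to [P]. *)
Definition cut_point (T : finType) (c : vertex H -> T) : {ffun hedge H -> R} :=
  [ffun e => (#|c @: setT|%:R - 1)^-1 * indicator R (crossing c) e].

Lemma AdmP rho : (2 <= #|vertex H|)%N ->
  Adm (multi_trees R H) rho <->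
  (forall e, 0 <= rho e) /\
  forall A, hypertree A -> 1 <= \sum_e (A e)%:R * rho e.
Proof.
move=> V2; split=> -[rho0 rho1]; split=> //.
  move=> A htA; have /rho1 : multi_trees R H [ffun e => (A e)%:R].
    by exists A; split=> //; exact: hypertree_cover.
  by rewrite (eq_bigr (fun e => (A e)%:R * rho e)) // => e _; rewrite ffunE.
move=> _ [A [htA _ ->]].
rewrite (eq_bigr (fun e => (A e)%:R * rho e)); first exact: rho1.
by move=> e _; rewrite ffunE.
Qed.

Lemma cut_pointE (T : finType) (c : vertex H -> T) e :
  cut_point c e = if e \in crossing c then (#|c @: setT|%:R - 1)^-1 else 0.
Proof. by rewrite !ffunE; case: ifP => _; rewrite ?mulr1 ?mulr0. Qed.

Lemma weight_cut_point (T : finType) (c : vertex H -> T) A :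
  \sum_e (A e)%:R * cut_point c e =
  (#|c @: setT|%:R - 1)^-1 * (\sum_(e in crossing c) A e)%N%:R.
Proof.
rewrite natr_sum mulr_sumr [RHS]big_mkcond; apply: eq_bigr => e _ /=.
by rewrite cut_pointE; case: ifP => _; rewrite ?mulr0 // mulrC.
Qed.

Lemma cut_point_Adm (T : finType) (c : vertex H -> T) :
  (2 <= #|vertex H|)%N -> (2 <= #|c @: setT|)%N ->
  Adm (multi_trees R H) (cut_point c).
Proof.
move=> V2 c2; have k0 : 0 < #|c @: setT|%:R - 1 :> R by rewrite subr_gt0 ltr1n.
apply/AdmP => //; split=> [e|A htA].
  by rewrite cut_pointE; case: ifP => // _; rewrite invr_ge0 ltW.
rewrite weight_cut_point mulrC ler_pdivlMr // mul1r.
rewrite lerBlDr natr1 ler_nat.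
by have := hypertree_crossing c htA; rewrite leq_subLR add1n.
Qed.

(** The fibres of [c] are the components of the zero-cost hyperedges; the last property of [c] later
    yields feasibility of the partition. *)
Lemma extreme_cut_point rho :
  connected_hg H -> (2 <= #|vertex H|)%N -> blocker (multi_trees R H) rho ->
  exists c : vertex H -> vertex H,
  [/\ (2 <= #|c @: setT|)%N, rho = cut_point c &
      forall (Y : {set vertex H}) a b, a \in Y -> b \notin Y -> c a = c b ->
      exists e u v, [/\ e \notin crossing c, u \in ends e, v \in ends e,
                        u \in Y & v \notin Y]].
Proof.
move=> Hc V2 [/AdmP[//|rho0 rho1] ext].
have [c [A0 [Fc A0rho _ mono conn]]] :=
  forest_grow setT [set e | rho e == 0] (forest_id H).
have {}A0rho e : (madd [ffun=> 0%N] A0 e)%:R * rho e = 0.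
  rewrite !ffunE; case: (posnP (A0 e)) => [->|/A0rho]; first by rewrite mul0r.
  by rewrite inE => /eqP ->; rewrite mulr0.
have zero_inner e : rho e = 0 -> e \notin crossing c.
  move=> re; apply/crossingP => -[a [b [ae be /eqP[]]]].
  by apply: (mono e); rewrite !inE ?re ?ae ?be.
(* With a single component the zero-cost forest would be a hypertree of cost 0. *)
have c2 : (2 <= #|c @: setT|)%N.
  rewrite ltnNge; apply/negP => c1.
  have /rho1 : hypertree (madd [ffun=> 0%N] A0).
    apply: forest_hypertree Fc _; apply/eqP; rewrite eqn_leq c1 card_gt0.
    by rewrite imset_eq0 -card_gt0 cardsT ltnW.
  by rewrite big1 ?ler10.
have [e0 e0c] : exists e, e \in crossing c.
  move: c2 => /card_gt1P[_ [_ [/imsetP[a _ ->] /imsetP[b _ ->] ab]]].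
  exact: connected_crossing Hc ab.
have [e ec emin] := arg_minP rho e0c.
have re : 0 < rho e.
  by rewrite lt_neqAle rho0 andbT eq_sym; apply: contraL ec => /eqP/zero_inner.
pose k : R := #|c @: setT|%:R - 1.
have k0 : 0 < k by rewrite subr_gt0 ltr1n.
(* The bound [rho e * k] keeps [rho] minus [s] times the cut point nonnegative, and 1/2 keeps [s]
   below 1. *)
pose s := Num.min (rho e * k) (1/2).
have s0 : 0 < s by rewrite lt_min mulr_gt0 //=; lra.
have s1 : 0 < 1 - s by rewrite subr_gt0 gt_min; apply/orP; right; lra.
have sm : s / k <= rho e by rewrite ler_pdivrMr // ge_min lexx.
have Adm_rest : Adm (multi_trees R H) [ffun g => (rho g - s * cut_point c g) / (1 - s)].
  apply/AdmP => //; split=> [g|B htB].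
    rewrite ffunE divr_ge0 ?(ltW s1) // subr_ge0 cut_pointE; case: ifP => [gc|_].
      by apply: le_trans sm _; exact: emin.
    by rewrite mulr0.
  (* The run continues from the zero-cost forest with costs lowered by [s / k]. Its [k] new members
     have reduced cost at least [1 - s], and minimality passes this bound on to [B]. *)
  have [||A1 [htA A1c minA]] :=
    @kruskal H R _ c _ (fun g => rho g - s / k) Hc _ Fc _.
  - exact: ltnW.
  - by move=> g gc; rewrite /= subr_ge0 (le_trans sm) //; exact: emin.
  have A1k : (\sum_g A1 g)%N%:R = k.
    have [_ htAV] := htA; have [_ FcV] := Fc; move: htAV.
    rewrite sum_madd => htAV; apply/eqP; rewrite eq_sym subr_eq natr1 eqr_nat.
    by apply/eqP; lia.
  have A1rho : 1 <= \sum_g (A1 g)%:R * rho g.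
    apply: le_trans (rho1 _ htA) _; apply: ler_sum => g _.
    by rewrite ffunE natrD mulrDl A0rho add0r.
  have := minA B htB; rewrite weight_support // !weightB A1k.
  rewrite [k * _]mulrC divfK ?gt_eqF // => minB.
  rewrite (eq_bigr (fun g =>
      ((B g)%:R * rho g - s * ((B g)%:R * cut_point c g)) / (1 - s))); last first.
    by move=> g _; rewrite ffunE mulrA mulrBr [s * (_ * _)]mulrCA.
  rewrite -mulr_suml ler_pdivlMr // mul1r sumrB -mulr_sumr weight_cut_point.
  have : \sum_(g in crossing c) (B g)%:R * rho g <= \sum_g (B g)%:R * rho g.
    rewrite [leRHS](bigID (mem (crossing c))) /= lerDl sumr_ge0 // => g _.
    by rewrite mulr_ge0 ?ler0n.
  rewrite -/k; lra.
have [||] := ext _ _ s (cut_point_Adm V2 c2) Adm_rest.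
- by rewrite s0 -subr_gt0.
- by move=> g; rewrite [X in _ + _ * X]ffunE [(1 - s) * _]mulrC divfK ?gt_eqF // addrC subrK.
move=> cut_rho _; exists c; split=> // Y a b aY bY ab.
have [|f [u [v [fr /setIP[uf _] /setIP[vf _] uY vY]]]] := conn Y _ a b aY bY ab.
  by move=> x y ->.
exists f, u, v; split=> //; apply: zero_inner; apply/eqP.
by move: fr; rewrite inE.
Qed.

End Cuts.

(** * Cut vertices and pendant hyperedges *)

Section Biconnected.
Variables (R : realType) (H : hypergraph).

(* [X] without the fibre of [p] and the rest without that fibre are the two
   sides of a cut vertex. *)
Lemma split_not_extreme (T : finType) (c : vertex H -> T) (X : {set vertex H}) p a b :
  connected_hg H -> (2 <= #|vertex H|)%N ->
  (forall x y, c x = c y -> x \in X -> y \in X) ->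
  c a != c p -> c b != c p -> a \in X -> b \notin X ->
  (forall (e : hedge H) u v, u \in ends e -> v \in ends e ->
     c u != c p -> c v != c p -> u \in X -> v \in X) ->
  ~ blocker (multi_trees R H) (cut_point R c).
Proof.
move=> Hc V2 Xsat ap bp aX bX uncrossed [_ ext].
(* [d Y] keeps the fibres in [Y] other than that of [p] and collapses everything else into [None];
   [n Y] counts the kept fibres. *)
pose d (Y : {set vertex H}) x := if (x \in Y) && (c x != c p) then Some (c x) else None.
pose n (Y : {set vertex H}) := #|c @: [set x in Y | c x != c p]|.
have nE : (#|c @: setT| = n X + n (~: X) + 1)%N.
  have -> : c @: setT = c p |: (c @: [set x in X | c x != c p] :|:
                               c @: [set x in ~: X | c x != c p]).
    apply/setP => t; rewrite in_setU1 -imsetU; apply/imsetP/orP => [[x _ ->]|].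
      case: (eqVneq (c x) (c p)) => [|xp]; first by left.
      by right; rewrite imset_f // !inE xp !andbT orbN.
    by case=> [/eqP ->|/imsetP[x _ ->]]; [exists p | exists x]; rewrite ?inE.
  rewrite cardsU1 cardsU disjoint_setI0 ?cards0 ?subn0.
    rewrite (_ : _ \notin _) 1?addnC // -imsetU.
    by apply/imsetP => -[x]; rewrite !inE => /orP[] /andP[_ /eqP xp] px; apply: xp.
  rewrite -setI_eq0; apply/eqP/setP => t; rewrite !inE; apply/andP.
  move=> [/imsetP[x xX ->] /imsetP[y]]; rewrite !inE => /andP[yX _] xy.
  by move: xX; rewrite inE => /andP[/(Xsat _ _ xy)]; rewrite (negPf yX).
have dE Y : (#|d Y @: setT| = (n Y).+1)%N.
  rewrite (_ : d Y @: setT = None |: Some @: (c @: [set x in Y | c x != c p])).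
    rewrite cardsU1 card_imset; last by move=> ? ? [].
    by rewrite (_ : _ \notin _) //; apply/imsetP => -[].
  apply/setP => t; rewrite in_setU1 -imset_comp; apply/imsetP/orP => [[x _ ->]|].
    rewrite /d; case: ifP => xY; last by left.
    by right; apply/imsetP; exists x; rewrite ?inE.
  case=> [/eqP ->|/imsetP[x]]; first by exists p; rewrite // /d eqxx andbF.
  by rewrite inE => xY ->; exists x; rewrite // /d xY.
have nX : (0 < n X)%N.
  by rewrite card_gt0; apply/set0Pn; exists (c a); rewrite imset_f // inE aX.
have nXC : (0 < n (~: X))%N.
  by rewrite card_gt0; apply/set0Pn; exists (c b); rewrite imset_f // !inE bX.
have dcoarse (Y : {set vertex H}) (e : hedge H) : (forall x y, c x = c y -> x \in Y -> y \in Y) ->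
    e \in crossing (d Y) -> e \in crossing c.
  move=> Ysat /crossingP[u [v [ue ve uv]]]; apply/crossingP; exists u, v; split=> //.
  apply: contraNneq uv => uv; rewrite /d uv.
  by rewrite (_ : (u \in Y) = (v \in Y)) //; apply/idP/idP; apply: Ysat.
have XCsat x y : c x = c y -> x \in ~: X -> y \in ~: X.
  by move=> xy; rewrite !inE; apply: contra; apply: Xsat.
have dY (Y : {set vertex H}) (e : hedge H) : e \in crossing (d Y) -> exists2 u, u \in ends e & (u \in Y) && (c u != c p).
  move=> /crossingP[u [v [ue ve]]]; rewrite /d.
  case: ifP => [uY _|_]; first by exists u.
  by case: ifP => [vY _|_]; [exists v | rewrite eqxx].
(* A hyperedge crossing [d Y] has an end in [Y] off the fibre of [p]; by [uncrossed] none has such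
   ends on both sides. *)
have excl e : e \in crossing (d X) -> e \notin crossing (d (~: X)).
  move=> /dY[u ue /andP[uX up]]; apply/negP => /dY[v ve].
  by rewrite inE => /andP[/negP vX vp]; apply: vX; exact: (uncrossed e u v).
(* A crossing hyperedge has an end off the fibre of [p], and it crosses the cut of the side
   containing that end. *)
have cover e : e \in crossing c -> (e \in crossing (d X)) || (e \in crossing (d (~: X))).
  have one u v : u \in ends e -> v \in ends e -> c u != c v -> c u != c p ->
     (e \in crossing (d X)) || (e \in crossing (d (~: X))).
    move=> ue ve uv up; apply/orP; case uX: (u \in X); [left|right];
      apply/crossingP; exists u, v; split=> //; rewrite /d ?in_setC uX up /=;
      by case: ifP => // _; apply: contraNneq uv => -[->].
  move=> /crossingP[u [v [ue ve uv]]].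
  have [up|] := eqVneq (c u) (c p); last exact: one ue ve uv.
  by apply: (one v u); rewrite // -?up eq_sym.
(* Since [d X] has [n X + 1] fibres, this weight turns the scaling of its cut point into that of
   [c]. *)
pose t : R := (n X)%:R / (#|c @: setT|%:R - 1).
have knE : #|c @: setT|%:R - 1 = (n X)%:R + (n (~: X))%:R :> R.
  by rewrite nE natrD addrK natrD.
have nX0 : 0 < (n X)%:R :> R by rewrite ltr0n.
have nXC0 : 0 < (n (~: X))%:R :> R by rewrite ltr0n.
have k0 : (n X)%:R + (n (~: X))%:R != 0 :> R by rewrite gt_eqF // addr_gt0.
have [|||| dX dXC] := ext (cut_point R (d X)) (cut_point R (d (~: X))) t.
- by apply: cut_point_Adm; rewrite // dE.
- by apply: cut_point_Adm; rewrite // dE.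
- rewrite /t knE divr_gt0 ?addr_gt0 //= ltr_pdivrMr ?addr_gt0 // mul1r; lra.
- move=> e; rewrite !cut_pointE !dE -!natr1 !addrK /t knE.
  case eX: (e \in crossing (d X)).
    rewrite (dcoarse X) // (negPf (excl _ eX)) mulr0 addr0 mulrAC.
    by rewrite divff ?mul1r // gt_eqF.
  case eXC: (e \in crossing (d (~: X))).
    rewrite (dcoarse (~: X)) // mulr0 add0r.
    by field; rewrite k0 gt_eqF.
  case: ifP => [/cover|_]; first by rewrite eX eXC.
  by rewrite !mulr0 addr0.
have [e eX] : exists e, e \in crossing (d X).
  by apply: (@connected_crossing _ _ _ a p Hc); rewrite /d aX ap eqxx andbF.
have := congr1 (fun rho : {ffun hedge H -> R} => rho e) (etrans dX (esym dXC)).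
rewrite !cut_pointE eX (negPf (excl _ eX)) dE -natr1 addrK => /eqP.
by rewrite invr_eq0 gt_eqF.
Qed.

(** The forest grows first inside the parts, then across them through ends outside the part of [p]
    only. This leaves that part and at most one further component, which any crossing [f] at that
    part joins to it. *)
Lemma pendant_tree (P : {set {set vertex H}}) p :
  feasible_partition P ->
  (forall (Y : {set vertex H}) a b,
    (forall x y, pblock P x = pblock P y -> x \in Y -> y \in Y) ->
    pblock P a != pblock P p -> pblock P b != pblock P p -> a \in Y -> b \notin Y ->
    exists e u v, [/\ u \in ends e, v \in ends e,
      pblock P u != pblock P p /\ pblock P v != pblock P p, u \in Y & v \notin Y]) ->
  exists A : {ffun hedge H -> nat}, (2 <= #|P| -> (\sum_(e in crossing (pblock P)) A e).+2 = #|P|)%N /\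
    forall f q, f \in crossing (pblock P) -> q \in ends f ->
      pblock P q = pblock P p -> hypertree (madd A (medge f)).
Proof.
move=> Pfeas bic; have [Ppart Pconn] := Pfeas.
have [c [A0 [Fc A0P _ cmono cconn]]] := forest_grow setT (~: delta P) (forest_id H).
move: Fc; set A0' := madd _ _ => Fc.
(* The first run recovers exactly [P]: its hyperedges do not leave a part, and each part is
   connected. *)
have cE x y : (c x == c y) = (pblock P x == pblock P y).
  apply/eqP/eqP => [xy|].
    apply/eqP; rewrite same_pblockT //; apply: contraT => yx.
    have [|e [u [v [eP /setIP[ue _] /setIP[ve _] ux vx]]]] :=
      cconn _ _ x y (mem_pblockT x Ppart) yx xy; first by move=> ? ? ->.
    move: eP; rewrite inE delta_crossing // => /crossingPn/(_ u v ue ve).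
    rewrite (pblock_eq Ppart (pblockT x Ppart) ux) => xv.
    by rewrite xv mem_pblockT in vx.
  move=> xy; apply/eqP; apply: contraT => cxy.
  have /induced_connectedP := Pconn _ (pblockT x Ppart).
  move=> /(_ [set z | c z == c x] x y (mem_pblockT x Ppart)).
  rewrite !inE eqxx -same_pblockT // xy eqxx eq_sym => /(_ erefl erefl cxy).
  move=> [e [u [v [eX ue ve]]]]; rewrite !inE => /eqP <- /eqP[].
  apply: (cmono e); rewrite ?in_setI ?ue ?ve ?in_setT // in_setC.
  by rewrite (subset_block_delta Ppart _ eX) // pblockT.
have [c' [A1 [Fc' A1P cc' mono conn]]] :=
  forest_grow [set x | pblock P x != pblock P p] (crossing (pblock P)) Fc.
have mono_all e u v : u \in ends e -> v \in ends e ->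
    pblock P u != pblock P p -> pblock P v != pblock P p -> c' u = c' v.
  move=> ue ve up vp; case: (boolP (e \in crossing (pblock P))) => [eP|/crossingPn eP].
    by apply: (mono e); rewrite // !inE ?ue ?ve ?up ?vp.
  by apply/cc'/eqP; rewrite cE (eP u v).
(* Otherwise the component of [a] is left by a hyperedge through ends off the part of [p], but the
   maximal run has already merged such ends. *)
have Umono a b : pblock P a != pblock P p -> pblock P b != pblock P p -> c' a = c' b.
  move=> ap bp; apply/eqP; rewrite eq_sym; apply: contraT => ab.
  have [|||e [u [v [ue ve [up vp]]]]] := bic [set x | c' x == c' a] a b _ ap bp.
  - move=> x y /eqP; rewrite -cE !inE => /eqP/cc' ->.
    by [].
  - by rewrite inE.
  - by rewrite inE.
  by rewrite !inE => /eqP <- /eqP[]; exact: (mono_all e).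
(* No merge of the second run goes through an end in the part of [p], so this part stays a
   component. *)
have Up a : pblock P a != pblock P p -> c' a != c' p.
  move=> ap; apply/eqP => cap.
  have [||e [u [v [eP]]]] := conn (pblock P p) _ p a (mem_pblockT p Ppart) _ (esym cap).
  - by move=> x y /eqP; rewrite cE -!same_pblockT // => /eqP ->.
  - by rewrite -same_pblockT // eq_sym.
  by rewrite !inE -same_pblockT // eq_sym => /andP[_ /negPf ->].
exists (madd A0' A1); split=> [P2|f q fP qf qp].
  have [r rp] : exists r, pblock P r != pblock P p.
    move: P2; rewrite -{1}(imset_pblock Ppart).
    move=> /card_gt1P[_ [_ [/imsetP[u _ ->] /imsetP[v _ ->] uv]]].
    have [up|] := eqVneq (pblock P u) (pblock P p); last by exists u.
    by exists v; rewrite -up eq_sym.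
  (* Two components out of [#|P|] remain, so the second run takes [#|P| - 2] hyperedges, all of them
     crossing. *)
  have c'2 : #|c' @: setT| = 2.
    rewrite (_ : _ @: _ = [set c' r; c' p]) ?cards2 ?Up //.
    apply/setP => t; rewrite !inE; apply/imsetP/orP => [[x _ ->]|[]/eqP ->].
    - have [xp|xp] := eqVneq (pblock P x) (pblock P p).
        by right; apply/eqP/cc'/eqP; rewrite cE xp.
      by left; rewrite (Umono x r).
    - by exists r.
    - by exists p.
  have cP : #|c @: setT| = #|P|.
    transitivity #|pblock P @: setT|; last by rewrite imset_pblock.
    apply/eqP; rewrite eqn_leq.
    by rewrite !leq_card_imset_factor // => x y _ _ /eqP; [rewrite cE|rewrite -cE];
       move=> /eqP.
  have A0sum : (\sum_(e in crossing (pblock P)) A0' e = 0)%N.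
    rewrite big1 // => e eP; rewrite !ffunE add0n; apply/eqP; rewrite -leqn0 leqNgt.
    by apply: contraL eP => /A0P; rewrite in_setC delta_crossing.
  have A1sum : (\sum_(e in crossing (pblock P)) A1 e = \sum_e A1 e)%N.
    rewrite [RHS](bigID (mem (crossing (pblock P)))) /= [X in (_ + X)%N]big1 ?addn0 //.
    move=> e; apply: contraNeq => /negP A1e; apply: A1P; rewrite lt0n.
    exact/negP.
  rewrite sum_madd A0sum A1sum -cP.
  move: Fc Fc' => [_ cV] [_]; rewrite sum_madd c'2 -cV; lia.
have [r rf rp] : exists2 r, r \in ends f & pblock P r != pblock P p.
  move/crossingP: fP => [u [v [uf vf uv]]].
  have [up|] := eqVneq (pblock P u) (pblock P p); last by exists u.
  by exists v; rewrite // -up eq_sym.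
have cqp : c' q = c' p by apply/cc'/eqP; rewrite cE qp.
have qr : c' q != c' r by rewrite cqp eq_sym Up.
apply: forest_hypertree (forest_merge Fc' qf rf qr) _.
rewrite (_ : _ @: _ = [set c' q]) ?cards1 //; apply/setP => t; rewrite inE.
apply/imsetP/eqP => [[x _ ->]|->]; last by exists q; rewrite // /merge (negPf qr).
rewrite /merge; case: eqVneq => // xr.
have [xp|xp] := eqVneq (pblock P x) (pblock P p).
  by rewrite cqp; apply/cc'/eqP; rewrite cE xp.
by rewrite (Umono x r) ?eqxx in xr.
Qed.

End Biconnected.

(** * Extremality of the cut points with biconnected shrunk hypergraph *)

Section Extremality.
Variables (R : realType) (H : hypergraph).

(** Treats one end of the segment; the other follows by exchanging [y] with [z] and [t] with
    [1 - t]. *)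
Lemma Adm_part_cut_point (P : {set {set vertex H}}) (y z : {ffun hedge H -> R}) (t : R) :
  connected_hg H -> (2 <= #|vertex H|)%N ->
  feasible_partition P -> (2 <= #|P|)%N -> vertex_biconnected (shrunk P) ->
  Adm (multi_trees R H) y -> Adm (multi_trees R H) z -> 0 < t < 1 ->
  (forall e, cut_point R (pblock P) e = t * y e + (1 - t) * z e) ->
  y = cut_point R (pblock P).
Proof.
move=> Hc V2 Pfeas P2 [_ /delete_contract_connectedP bic] yAdm zAdm /andP[t0 t1] yz.
have [y0 y1] := (AdmP y V2).1 yAdm; have [z0 z1] := (AdmP z V2).1 zAdm.
have Ppart := Pfeas.1; rewrite -subr_gt0 in t1.
rewrite merged_delta // in bic.
have out e : e \notin crossing (pblock P) -> y e = 0.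
  move=> eP; have := yz e; rewrite cut_pointE (negPf eP).
  have := mulr_ge0 (ltW t0) (y0 e); have := mulr_ge0 (ltW t1) (z0 e) => tz ty tyz.
  have /eqP : t * y e = 0 by lra.
  by rewrite mulf_eq0 gt_eqF //= => /eqP.
pose k : R := #|P|%:R - 1.
have k0 : 0 < k by rewrite subr_gt0 ltr1n.
have cutE e : cut_point R (pblock P) e = if e \in crossing (pblock P) then k^-1 else 0.
  by rewrite cut_pointE imset_pblock.
(* Such a hypertree has cost 1 at the cut point, a proper average of its costs at [y] and [z]; both
   are at least 1, hence equal to 1. *)
have tight A : hypertree A -> (\sum_(e in crossing (pblock P)) A e).+1 = #|P| ->
    \sum_(e in crossing (pblock P)) (A e)%:R * y e = 1.
  move=> htA AP; have wy := y1 A htA; have wz := z1 A htA.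
  have : \sum_e (A e)%:R * cut_point R (pblock P) e = 1.
    by rewrite weight_cut_point imset_pblock // -AP -natr1 addrK mulVf // gt_eqF //
       -[X in _ < X](addrK 1) natr1 AP.
  rewrite (eq_bigr (fun e => t * ((A e)%:R * y e) + (1 - t) * ((A e)%:R * z e))).
    rewrite big_split /= -!mulr_sumr => tyz.
    have wyE : \sum_e (A e)%:R * y e = 1.
      have := ler_wpM2l (ltW t1) wz; have := ler_wpM2l (ltW t0) wy.
      move=> h1 h2; apply/eqP; rewrite -(inj_eq (mulfI (negbT (gt_eqF t0)))).
      by apply/eqP; lra.
    rewrite -[RHS]wyE [RHS](bigID (mem (crossing (pblock P)))) /=.
    by rewrite [X in _ = _ + X]big1 ?addr0 // => e /out ->; rewrite mulr0.
  by move=> e _; rewrite yz mulrDr mulrCA [X in _ + X]mulrCA.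
(* [S] is the [y]-cost of the multi-tree at [p] without its pendant hyperedge. *)
have adj p : exists2 S, forall f q, f \in crossing (pblock P) -> q \in ends f ->
    pblock P q = pblock P p -> S + y f = 1 &
    forall r, (forall f, f \in crossing (pblock P) -> y f = r) -> S = (k - 1) * r.
  have [A [/(_ P2) AP Af]] := pendant_tree Pfeas (fun Y => bic Y p).
  exists (\sum_(e in crossing (pblock P)) (A e)%:R * y e).
    move=> f q fP qf qp; rewrite -[RHS](tight _ (Af f q fP qf qp)); last first.
      by rewrite sum_madd sum_medge fP addn1.
    under [RHS]eq_bigr do rewrite !ffunE natrD mulrDl.
    rewrite big_split /= [X in _ = _ + X](bigD1 f) //= eqxx mul1r.
    by rewrite [X in _ + (_ + X)]big1 ?addr0 // => g /andP[_ /negPf ->]; rewrite mul0r.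
  move=> r yr; rewrite (eq_bigr (fun e => (A e)%:R * r)); last by move=> e /yr ->.
  rewrite -mulr_suml -natr_sum; congr (_ * _).
  by rewrite /k -AP -!natr1 !addrK.
have [f0 f0P] : exists f, f \in crossing (pblock P).
  move: P2; rewrite -{1}(imset_pblock Ppart).
  move=> /card_gt1P[_ [_ [/imsetP[u _ ->] /imsetP[v _ ->] uv]]].
  exact: connected_crossing Hc uv.
have const f : f \in crossing (pblock P) -> y f = y f0.
  (* [S] is the union of the parts met by a crossing hyperedge of value [y f0]. By [adj] every
     crossing hyperedge meeting [S] has this value, so no hyperedge leaves [S], and by connectedness
     [S] is everything. *)
  pose S := [set x | [exists g, [&& g \in crossing (pblock P), y g == y f0 &
              [exists q in ends g, pblock P q == pblock P x]]]].
  have inS g x q : g \in crossing (pblock P) -> y g = y f0 -> q \in ends g ->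
      pblock P q = pblock P x -> x \in S.
    move=> gP /eqP gy qg /eqP qx; rewrite inE; apply/existsP; exists g.
    by rewrite gP gy; apply/existsP; exists q; rewrite qg.
  have eqS g x : g \in crossing (pblock P) -> x \in ends g -> x \in S -> y g = y f0.
    move=> gP xg; rewrite inE => /existsP[h /and3P[hP /eqP <- /existsP[q /andP[qh /eqP qx]]]].
    have [s sy _] := adj x; apply: (addrI s).
    by rewrite (sy h q) // (sy g x).
  have [x xf] := ends_exists f; move=> fP; apply: (eqS _ _ fP xf).
  have [w wf] := ends_exists f0.
  apply: contraT => xS; have [||e] := Hc S.
  - by apply/set0Pn; exists w; apply: (inS f0 w w).
  - by apply: contraNneq xS => ->; rewrite inE.
  move=> /andP[/set0Pn[u /setIP[ue uS]] /set0Pn[v /setIP[ve]]].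
  rewrite in_setC => /negP[].
  case: (boolP (e \in crossing (pblock P))) => [eP|/crossingPn/(_ u v ue ve) uv].
    by apply: (inS e v v) => //; exact: eqS eP ue uS.
  move: uS; rewrite inE => /existsP[g /and3P[gP /eqP gy /existsP[q /andP[qg /eqP qu]]]].
  by apply: (inS g v q) => //; rewrite qu.
apply/ffunP => f; rewrite cutE; case: ifP => [fP|/negbT/out //].
(* For constant [y] the equation at [w] reads [(k - 1) * y f0 + y f0 = 1], which fixes the constant
   as [k^-1]. *)
have [w wf] := ends_exists f0; have [S S1 SE] := adj w.
rewrite const //; have := S1 f0 w f0P wf erefl; rewrite (SE (y f0)) //.
rewrite mulrBl mul1r subrK => ky.
by apply: (mulfI (negbT (gt_eqF k0))); rewrite ky divff // gt_eqF.
Qed.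

End Extremality.

(** * Equality of the blocker with the family of cut points *)

Theorem theorem1p6 (R : realType) (H : hypergraph)
    (Hconn : connected_hg H) (Hcard : (2 <= #|vertex H|)%N) :
  blocker (multi_trees R H) =
  [set rho : {ffun hedge H -> R} | exists P : {set {set vertex H}},
     [/\ feasible_partition P, (2 <= #|P|)%N, vertex_biconnected (shrunk P) &
         rho = [ffun e => (#|P|%:R - 1)^-1 * indicator R (delta P) e]]]%classic.
Proof.
have cutE (P : {set {set vertex H}}) : partition P [set: vertex H] ->
    [ffun e => (#|P|%:R - 1)^-1 * indicator R (delta P) e] = cut_point R (pblock P).
  by move=> Ppart; rewrite /cut_point imset_pblock // delta_crossing.
apply/seteqP; split=> [rho rho_ext|_ [P [Pfeas P2 Pbic ->]]]; last first.
  have Ppart := Pfeas.1; rewrite cutE //; split.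
    by apply: cut_point_Adm; rewrite // imset_pblock.
  move=> y z t yAdm zAdm t01 yz; split; first exact: Adm_part_cut_point t01 yz.
  apply: (@Adm_part_cut_point _ _ P z y (1 - t)) => //.
    by move: t01; lra.
  by move=> e; rewrite yz subKr addrC.
have [c [c2 rhoE conn]] := extreme_cut_point Hconn Hcard rho_ext.
pose P := preim_partition c setT.
have Ppart : partition P [set: vertex H] := preim_partitionP c setT.
have cE x y : (c x == c y) = (pblock P x == pblock P y).
  rewrite same_pblockT // pblock_equivalence_partition ?inE //.
  by move=> u v w _ _ _; split=> [|/eqP ->].
have cross : crossing c = crossing (pblock P).
  apply/setP => e; apply/crossingP/crossingP => -[u [v [ue ve uv]]]; exists u, v;
    by [rewrite -cE | rewrite cE].
have cP : #|c @: setT| = #|P|.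
  transitivity #|pblock P @: setT|; last by rewrite imset_pblock.
  apply/eqP; rewrite eqn_leq.
  by rewrite !leq_card_imset_factor // => x y _ _ /eqP; [rewrite cE|rewrite -cE];
     move=> /eqP.
have Pfeas : feasible_partition P.
  split=> // X XP; apply/induced_connectedP => Y a b aX bX aY bY.
  have ab : c a = c b.
    by apply/eqP; rewrite cE (pblock_eq Ppart XP aX) (pblock_eq Ppart XP bX).
  (* Intersecting with [X] forces the hyperedge to meet [X]; as it does not cross, it lies inside
     [X]. *)
  have [||e [u [v [/crossingPn ec ue ve]]]] := conn (Y :&: X) a b _ _ ab.
  - by rewrite inE aY.
  - by rewrite inE (negPf bY).
  rewrite !inE => /andP[uY uX].
  have eX w : w \in ends e -> w \in X.
    move=> we; rewrite -(pblock_eq Ppart XP uX) -same_pblockT // -cE.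
    exact/eqP/ec.
  by rewrite (eX v ve) andbT => vY; exists e, u, v; split=> //; apply/subsetP.
exists P; split=> //; first by rewrite -cP.
  split; first exact: contract_connected.
  apply/delete_contract_connectedP; rewrite merged_delta // => X p a b Xsat.
  (* If no hyperedge joins the two sides away from [p], they form a split at a cut vertex, against
     extremality of [rho]. *)
  rewrite -!cE => ap bp aX bX; apply: contrapT => none.
  apply: (@split_not_extreme R H _ c X p a b) => //; last by rewrite -rhoE.
    by move=> x y /eqP; rewrite cE => /eqP; exact: Xsat.
  move=> e u v ue ve up vp uX; apply: contraT => vX; case: none.
  by exists e, u, v; rewrite -!cE.
by rewrite cutE // rhoE /cut_point cP imset_pblock // cross.
Qed.
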